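(* For every $1<\alpha<2$, $$\|\mathcal{H}\|_{\mathcal{B}^\alpha\to\mathcal{B}^\alpha_{\log}}\ge\frac{1}{2(\alpha-1)}\int_0^1(1-t^2)^{1-\alpha}\,dt+\frac{3\alpha-5}{4(\alpha-1)(2-\alpha)}.$$ Moreover, for every $\alpha$ with $0<\alpha<1$ or $\alpha\ge 2$, the Hilbert matrix operator $\mathcal{H}$ does not map $\mathcal{B}^\alpha$ into $\mathcal{B}^\alpha_{\log}$.
   Context: Let $\mathbb{D}$ be the open unit disk of $\mathbb{C}$ and $H(\mathbb{D})$ the set of all analytic functions in $\mathbb{D}$. For $f(z)=\sum_{k=0}^\infty a_kz^k\in H(\mathbb{D})$, the Hilbert matrix operator is defined by $$\mathcal{H}f(z)=\sum_{n=0}^\infty\left(\sum_{k=0}^\infty\frac{a_k}{n+k+1}\right)z^n,$$ whenever the right-hand side makes sense (the inner series converging as ordinary limits of partial sums) and defines an analytic function in $\mathbb{D}$. For $0<\alpha<\infty$, the $\alpha$-Bloch space $\mathcal{B}^\alpha$ consists of all $f\in H(\mathbb{D})$ with $$\|f\|_{\mathcal{B}^\alpha}=|f(0)|+\sup_{z\in\mathbb{D}}(1-|z|^2)^\alpha|f'(z)|<\infty,$$ and the logarithmically weighted $\alpha$-Bloch space $\mathcal{B}^\alpha_{\log}$ consists of all $f\in H(\mathbb{D})$ with $$\|f\|_{\mathcal{B}^\alpha_{\log}}=|f(0)|+\sup_{z\in\mathbb{D}}\left(\log\frac{e}{(1-|z|)^2}\right)^{-1}(1-|z|^2)^\alpha|f'(z)|<\infty.$$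 The operator norm is $\|\mathcal{H}\|_{\mathcal{B}^\alpha\to\mathcal{B}^\alpha_{\log}}=\sup\{\|\mathcal{H}f\|_{\mathcal{B}^\alpha_{\log}}/\|f\|_{\mathcal{B}^\alpha}: 0\ne f\in\mathcal{B}^\alpha\}$. That $\mathcal{H}$ does not map $\mathcal{B}^\alpha$ into $\mathcal{B}^\alpha_{\log}$ means that there is $f\in\mathcal{B}^\alpha$ for which $\mathcal{H}f$ either is not defined or does not belong to $\mathcal{B}^\alpha_{\log}$. *)

(* Defs.v *)
From Stdlib Require Import Reals.
From Coquelicot Require Import Coquelicot.

Open Scope R_scope.

(* Functions on the unit disk are total maps [C -> C] of which only the values
   on the disk matter. *)
Definition in_disk (z : C) : Prop := Cmod z < 1.

Definition analytic_in_disk (f : C -> C) : Prop :=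
  forall z : C, in_disk z -> ex_derive (K := C_AbsRing) (V := C_NormedModule) f z.

Definition power_series_in_disk (a : nat -> C) (f : C -> C) : Prop :=
  forall z : C, in_disk z ->
    is_pseries (K := C_AbsRing) (V := C_NormedModule) a z (f z).

(* The Hilbert matrix operator is partial: [is_hilbert f g] says that it is
   defined at [f] and that its value is [g]. *)
Definition is_hilbert (f g : C -> C) : Prop :=
  exists a b : nat -> C,
    power_series_in_disk a f /\
    (forall n : nat,
       is_series (K := C_AbsRing) (V := C_NormedModule)
         (fun k : nat => (a k / RtoC (INR (n + k + 1)))%C) (b n)) /\
    power_series_in_disk b g /\
    analytic_in_disk g.

Definition weighted_norm (w : R -> R) (f : C -> C) : Rbar :=
  Rbar_plus (Finite (Cmod (f (RtoC 0))))
    (Lub_Rbar (fun x : R => exists z : C,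
       in_disk z /\ x = w (Cmod z) * Cmod (C_derive f z))).

Definition bloch_weight (alpha r : R) : R := Rpower (1 - r ^ 2) alpha.

Definition bloch_log_weight (alpha r : R) : R :=
  / ln (exp 1 / (1 - r) ^ 2) * Rpower (1 - r ^ 2) alpha.

Definition bloch_norm (alpha : R) : (C -> C) -> Rbar :=
  weighted_norm (bloch_weight alpha).

Definition bloch_log_norm (alpha : R) : (C -> C) -> Rbar :=
  weighted_norm (bloch_log_weight alpha).

Definition in_bloch (alpha : R) (f : C -> C) : Prop :=
  analytic_in_disk f /\ Rbar_lt (bloch_norm alpha f) p_infty.

Definition in_bloch_log (alpha : R) (f : C -> C) : Prop :=
  analytic_in_disk f /\ Rbar_lt (bloch_log_norm alpha f) p_infty.

(* The supremum, possibly [p_infty], is over the nonzero [f] in the Bloch space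
   at which the operator is defined; no value is assigned to it elsewhere. *)
Definition hilbert_norm (alpha : R) : Rbar :=
  Rbar_lub (fun q : Rbar => exists f g : C -> C,
    in_bloch alpha f /\
    (exists z : C, in_disk z /\ f z <> RtoC 0) /\
    is_hilbert f g /\
    q = Rbar_div (bloch_log_norm alpha g) (bloch_norm alpha f)).

Definition hilbert_does_not_map (alpha : R) : Prop :=
  exists f : C -> C,
    in_bloch alpha f /\
    ((~ exists g : C -> C, is_hilbert f g) \/
     (exists g : C -> C, is_hilbert f g /\ ~ in_bloch_log alpha g)).

(* Main.v *)
Require Import Defs.
From Stdlib Require Import Reals Lra Lia.
From Coquelicot Require Import Coquelicot.
Open Scope R_scope.

(** The operator is seen through coefficients: every function used is the sum
    [CPSeries a] of a power series with nonnegative real coefficients, so that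
    |f(z)| <= f(|z|) and |f'(z)| <= f'(|z|), and the Bloch norms reduce to real
    power series on [0, 1).

    For 1 < alpha < 2, put beta = alpha - 1 and take
      f(z) = ((1 - z^2)^(-beta) - 1) / (2 beta),   f'(z) = z (1 - z^2)^(-alpha).
    Then f(0) = 0 and (1 - |z|^2)^alpha |f'(z)| <= |z| <= 1, so f has norm at
    most 1.  Already at the origin, where the logarithmic weight is 1, the norm
    of g = H f is at least |g(0)| + |g'(0)| = b_0 + b_1, where b_n is the sum of
    a_k / (n + k + 1), that is, the integral over (0, 1) of t^n f(t).  The first
    integral is (J - 1) / (2 beta), with J the integral of (1 - t^2)^(1 - alpha)
    ([is_RInt_gen_extremal]), the second is 1 / (4 (2 - alpha))
    ([hilbert_coef_extremal_1]), and b_0 + b_1 is the asserted bound.  The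
    integral and the sum are exchanged by monotonicity: a power series with
    nonnegative coefficients that is bounded on (0, 1) converges at 1, and its
    sum is continuous there from the left ([ex_series_of_bounded_PSeries],
    [filterlim_PSeries_at_left_1]).

    For alpha >= 2 the function 1 / (1 - z) lies in the Bloch space, and the
    zeroth coefficient of its image would be the sum of the harmonic series.
    For 0 < alpha < 1 the constant 1 has the image with coefficients
    1 / (n + 1), whose derivative is at least 1 / (2 (1 - r)) at r in [0, 1);
    multiplied by the weight this exceeds a multiple of
    (1 - r)^(alpha - 1) / log (e / (1 - r)^2), which is unbounded. *)

(** * Complex series and the real series of their parts *)

Notation is_Cseries := (is_series (K := C_AbsRing) (V := C_NormedModule)).
Notation is_Cpseries := (is_pseries (K := C_AbsRing) (V := C_NormedModule)).

Lemma pow_n_Cpow (z : C) (n : nat) : pow_n (K := C_Ring) z n = (z ^ n)%C.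
Proof.
  induction n as [|n IH]; [reflexivity|].
  simpl; rewrite IH; reflexivity.
Qed.

Lemma sum_n_Re (u : nat -> C) (n : nat) :
  Re (sum_n (G := C_AbelianMonoid) u n) = sum_n (fun k => Re (u k)) n.
Proof.
  induction n as [|n IH]; [now rewrite !sum_O|].
  rewrite !sum_Sn, <- IH; reflexivity.
Qed.

Lemma sum_n_RtoC (u : nat -> R) (n : nat) :
  sum_n (G := C_AbelianMonoid) (fun k => RtoC (u k)) n = RtoC (sum_n u n).
Proof.
  induction n as [|n IH]; [now rewrite !sum_O|].
  rewrite !sum_Sn, IH; symmetry; apply RtoC_plus.
Qed.

Lemma is_Cseries_Re (u : nat -> C) (l : C) :
  is_Cseries u l -> is_series (fun n => Re (u n)) (Re l).
Proof.
  intros H; unfold is_series.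
  apply (filterlim_ext (fun n => Re (sum_n (G := C_AbelianMonoid) u n))).
  { apply sum_n_Re. }
  eapply filterlim_comp; [exact H|].
  destruct l as [x y]; apply (continuous_fst x y).
Qed.

Lemma is_Cseries_RtoC (u : nat -> R) (l : R) :
  is_series u l -> is_Cseries (fun n => RtoC (u n)) (RtoC l).
Proof.
  intros H; unfold is_series.
  apply (filterlim_ext (fun n => RtoC (sum_n u n))).
  { intros n; symmetry; apply sum_n_RtoC. }
  eapply filterlim_comp; [exact H|].
  intros P [eps He]; exists eps; intros x Hx; apply He; split; [exact Hx|].
  apply ball_center.
Qed.

Lemma Cmod_series_le (u : nat -> C) (v : nat -> R) (l : C) (s : R) :
  (forall n, Cmod (u n) <= v n) -> is_Cseries u l -> is_series v s ->
  Cmod l <= s.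
Proof.
  intros Hle Hu Hv.
  apply (is_lim_seq_le (fun n => Cmod (sum_n (G := C_AbelianMonoid) u n))
           (sum_n v) (Finite (Cmod l)) (Finite s)); [|  |exact Hv].
  - intros n; apply Rle_trans with (1 := norm_sum_n_m (K := C_AbsRing)
      (V := C_NormedModule) u 0 n).
    now apply sum_n_m_le.
  - unfold is_lim_seq; eapply filterlim_comp; [exact Hu|].
    apply (filterlim_norm (K := C_AbsRing) (V := C_NormedModule) l).
Qed.

(** * Complex power series with real coefficients *)

(** A total operator, like [PSeries]: it is the sum of the series wherever the
    series converges. *)
Definition CPSeries (a : nat -> R) (z : C) : C :=
  iota (T := C_CompleteNormedModule)
    (fun l => is_Cpseries (fun n => RtoC (a n)) z l).

Lemma is_Cpseries_unique (a : nat -> C) (z l1 l2 : C) :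
  is_Cpseries a z l1 -> is_Cpseries a z l2 -> l1 = l2.
Proof.
  intros H1 H2.
  apply (filterlim_locally_unique (K := C_AbsRing) (V := C_NormedModule) _ _ _ H1 H2).
Qed.

Lemma CPSeries_unique (a : nat -> R) (z l : C) :
  is_Cpseries (fun n => RtoC (a n)) z l -> CPSeries a z = l.
Proof.
  intros H; apply is_Cpseries_unique with (2 := H).
  unfold CPSeries; apply (iota_correct (K := C_AbsRing)
    (V := C_CompleteNormedModule)).
  exists l; split; [exact H|]; intros l'; now apply is_Cpseries_unique.
Qed.

Lemma Cmod_pseries_term (a : nat -> R) (z : C) (n : nat) :
  Cmod (scal (V := C_NormedModule) (pow_n (K := C_Ring) z n) (RtoC (a n)))
  = Rabs (a n * Cmod z ^ n).
Proof.
  change (Cmod (pow_n (K := C_Ring) z n * RtoC (a n))%C = Rabs (a n * Cmod z ^ n)).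
  rewrite pow_n_Cpow, Cmod_mult, Cmod_pow, Cmod_R, Rabs_mult.
  rewrite (Rabs_pos_eq (_ ^ _)); [ring|apply pow_le, Cmod_ge_0].
Qed.

Lemma CPSeries_correct (a : nat -> R) (z : C) :
  Rbar_lt (Cmod z) (CV_radius a) ->
  is_Cpseries (fun n => RtoC (a n)) z (CPSeries a z).
Proof.
  intros Hz.
  assert (E : ex_series (K := C_AbsRing) (V := C_NormedModule)
     (fun k => scal (V := C_NormedModule) (pow_n (K := C_Ring) z k) (RtoC (a k)))).
  { apply (ex_series_le (V := C_CompleteNormedModule) _
      (fun n => Rabs (a n * Cmod z ^ n))).
    - intros n; apply Req_le; exact (Cmod_pseries_term a z n).
    - apply CV_disk_inside; now rewrite Rabs_pos_eq by apply Cmod_ge_0. }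
  destruct E as [l Hl].
  now rewrite (CPSeries_unique a z l Hl).
Qed.

Lemma CPSeries_RtoC (a : nat -> R) (x : R) :
  Rbar_lt (Rabs x) (CV_radius a) -> CPSeries a (RtoC x) = RtoC (PSeries a x).
Proof.
  intros Hx; apply CPSeries_unique.
  assert (H : is_series (fun n => a n * x ^ n) (PSeries a x)).
  { apply (proj1 (is_pseries_R _ _ _)), PSeries_correct, CV_radius_inside, Hx. }
  apply is_Cseries_RtoC in H; revert H; apply is_series_ext; intros n.
  change (RtoC (a n * x ^ n) = pow_n (K := C_Ring) (RtoC x) n * RtoC (a n))%C.
  now rewrite pow_n_Cpow, RtoC_mult, RtoC_pow, Cmult_comm.
Qed.

Lemma CPSeries_0 (a : nat -> R) :
  Rbar_lt 0 (CV_radius a) -> CPSeries a (RtoC 0) = RtoC (a 0%nat).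
Proof.
  intros H; rewrite CPSeries_RtoC; [now rewrite PSeries_0|].
  now rewrite Rabs_R0.
Qed.

(** With nonnegative coefficients the sum is largest in modulus on the positive
    radius, which is how bounds on the disk come from real analysis. *)
Lemma Cmod_CPSeries_le (a : nat -> R) (z : C) :
  (forall n, 0 <= a n) -> Rbar_lt (Cmod z) (CV_radius a) ->
  Cmod (CPSeries a z) <= PSeries a (Cmod z).
Proof.
  intros Ha Hz.
  apply (Cmod_series_le _ (fun n => a n * Cmod z ^ n) _ _ )
    with (2 := CPSeries_correct a z Hz).
  - intros n; rewrite Cmod_pseries_term, Rabs_pos_eq; [lra|].
    apply Rmult_le_pos; [apply Ha|apply pow_le, Cmod_ge_0].
  - apply (proj1 (is_pseries_R _ _ _)), PSeries_correct, CV_radius_inside.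
    now rewrite Rabs_pos_eq by apply Cmod_ge_0.
Qed.

(** Induction through w^(n+2) - z^(n+2) = w (w^(n+1) - z^(n+1)) + (w - z) z^(n+1). *)
Lemma Cpow_sub_le (z w : C) (r : R) (n : nat) :
  Cmod z <= r -> Cmod w <= r ->
  Cmod (w ^ S n - z ^ S n)%C <= INR (S n) * r ^ n * Cmod (w - z).
Proof.
  intros Hz Hw; induction n as [|n IH].
  - simpl; rewrite !Cmult_1_r; lra.
  - replace (w ^ S (S n) - z ^ S (S n))%C
      with (w * (w ^ S n - z ^ S n) + (w - z) * z ^ S n)%C
      by (rewrite !(Cpow_S _ (S n)); ring).
    eapply Rle_trans; [apply Cmod_triangle|].
    rewrite !Cmod_mult, Cmod_pow.
    assert (H0 := Cmod_ge_0 w); assert (H1 := Cmod_ge_0 (w ^ S n - z ^ S n)).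
    assert (H2 := Cmod_ge_0 (w - z)).
    assert (H3 : Cmod z ^ S n <= r ^ S n) by (apply pow_incr; split; [apply Cmod_ge_0|exact Hz]).
    assert (H4 : Cmod w * Cmod (w ^ S n - z ^ S n)
       <= r * (INR (S n) * r ^ n * Cmod (w - z))) by (apply Rmult_le_compat; auto).
    assert (H5 : Cmod (w - z) * Cmod z ^ S n <= Cmod (w - z) * r ^ S n)
      by (apply Rmult_le_compat_l; auto).
    rewrite (S_INR (S n)).
    replace ((INR (S n) + 1) * r ^ S n * Cmod (w - z)) with
     (r * (INR (S n) * r ^ n * Cmod (w - z)) + Cmod (w - z) * r ^ S n)
     by (simpl (r ^ S n); ring).
    lra.
Qed.

(** Second-order remainder of w^(n+2) at z; the integral formula would give
    half of this constant.  The remainder of w^(m+1) is z times that of w^m plus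
    (w - z) (w^m - z^m), which the first-order estimate controls. *)
Lemma Cpow_taylor_le (z w : C) (r : R) (n : nat) :
  Cmod z <= r -> Cmod w <= r ->
  Cmod (w ^ S (S n) - z ^ S (S n) - INR (S (S n)) * z ^ S n * (w - z))%C
  <= INR (S n) * INR (S (S n)) * r ^ n * Cmod (w - z) ^ 2.
Proof.
  intros Hz Hw.
  assert (Hr : 0 <= r) by (apply Rle_trans with (2 := Hz), Cmod_ge_0).
  assert (Hd := Cmod_ge_0 (w - z)).
  induction n as [|n IH].
  - replace (w ^ 2 - z ^ 2 - INR 2 * z ^ 1 * (w - z))%C with ((w - z) * (w - z))%C.
    + rewrite Cmod_mult; simpl; nra.
    + simpl (INR 2); rewrite RtoC_plus; ring.
  - set (D := (w ^ S (S n) - z ^ S (S n) - INR (S (S n)) * z ^ S n * (w - z))%C) in *.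
    replace (w ^ S (S (S n)) - z ^ S (S (S n))
             - INR (S (S (S n))) * z ^ S (S n) * (w - z))%C
      with (z * D + (w - z) * (w ^ S (S n) - z ^ S (S n)))%C.
    2:{ unfold D; rewrite (S_INR (S (S n))), RtoC_plus.
        rewrite !(Cpow_S _ (S (S n))), !(Cpow_S _ (S n)); ring. }
    eapply Rle_trans; [apply Cmod_triangle|].
    rewrite !Cmod_mult.
    assert (H1 := Cpow_sub_le z w r (S n) Hz Hw).
    assert (H4 := Rmult_le_compat _ _ _ _ (Cmod_ge_0 z) (Cmod_ge_0 D) Hz IH).
    assert (H5 := Rmult_le_compat_l _ _ _ Hd H1).
    eapply Rle_trans; [apply Rplus_le_compat; [exact H4|exact H5]|].
    replace (r * (INR (S n) * INR (S (S n)) * r ^ n * Cmod (w - z) ^ 2) +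
      Cmod (w - z) * (INR (S (S n)) * r ^ S n * Cmod (w - z)))
      with ((INR (S n) + 1) * (INR (S (S n)) * r ^ S n * Cmod (w - z) ^ 2))
      by (simpl (r ^ S n); ring).
    replace (INR (S (S n)) * INR (S (S (S n))) * r ^ S n * Cmod (w - z) ^ 2)
      with (INR (S (S (S n))) * (INR (S (S n)) * r ^ S n * Cmod (w - z) ^ 2)) by ring.
    apply Rmult_le_compat_r.
    + apply Rmult_le_pos; [apply Rmult_le_pos|]; [apply pos_INR|now apply pow_le|].
      now apply pow_le.
    + rewrite (S_INR (S (S n))), (S_INR (S n)); lra.
Qed.

(** * Termwise differentiation *)
Definition Cterm (a : nat -> R) (z : C) (n : nat) : C := (RtoC (a n) * z ^ n)%C.

Lemma is_Cpseries_term (a : nat -> R) (z l : C) :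
  is_Cpseries (fun n => RtoC (a n)) z l <-> is_Cseries (Cterm a z) l.
Proof.
  assert (E : forall n, scal (V := C_NormedModule) (pow_n (K := C_Ring) z n) (RtoC (a n))
     = Cterm a z n).
  { intros n; change (pow_n (K := C_Ring) z n * RtoC (a n) = Cterm a z n)%C.
    rewrite pow_n_Cpow; apply Cmult_comm. }
  split; apply is_series_ext; intros n; [|symmetry]; apply E.
Qed.

(** Summing the termwise remainders gives a quadratic remainder whose constant
    is the twice differentiated series of absolute values at r, convergent
    because differentiation preserves the radius of convergence.  Complex differentiability follows at
    once. *)
Lemma CPSeries_taylor_le (a : nat -> R) (r : R) (z w : C) :
  Cmod z <= r -> Cmod w <= r -> Rbar_lt r (CV_radius a) ->
  Cmod (CPSeries a w - CPSeries a z - CPSeries (PS_derive a) z * (w - z))%C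
  <= Series (fun n => Rabs (PS_derive (PS_derive a) n * r ^ n)) * Cmod (w - z) ^ 2.
Proof.
  intros Hz Hw Hr.
  assert (Hr0 : 0 <= r) by (apply Rle_trans with (2 := Hz), Cmod_ge_0).
  assert (Hin : forall y b, Cmod y <= r -> Rbar_lt r (CV_radius b) ->
     is_Cseries (Cterm b y) (CPSeries b y)).
  { intros y b Hy Hb; apply (proj1 (is_Cpseries_term _ _ _)), CPSeries_correct.
    apply Rbar_le_lt_trans with (2 := Hb); exact Hy. }
  assert (Hr1 : Rbar_lt r (CV_radius (PS_derive a))) by now rewrite CV_radius_derive.
  pose (t n := (Cterm a w n - Cterm a z n
     - match n with 0%nat => 0 | S m => Cterm (PS_derive a) z m end * (w - z))%C).
  assert (Ht : is_Cseries t
     (CPSeries a w - CPSeries a z - CPSeries (PS_derive a) z * (w - z))%C).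
  { assert (Hd : is_Cseries
       (fun n => match n with 0%nat => RtoC 0 | S m => Cterm (PS_derive a) z m end)
       (CPSeries (PS_derive a) z)).
    { apply (is_series_decr_1 (K := C_AbsRing) (V := C_NormedModule)).
      replace (plus _ _) with (CPSeries (PS_derive a) z); [now apply Hin|].
      change (CPSeries (PS_derive a) z = (CPSeries (PS_derive a) z + - RtoC 0)%C); ring. }
    apply (is_series_scal (K := C_AbsRing) (V := C_NormedModule) (w - z)%C) in Hd.
    assert (H := is_series_minus (K := C_AbsRing) (V := C_NormedModule) _ _ _ _
       (Hin w a Hw Hr) (Hin z a Hz Hr)).
    assert (H' := is_series_minus (K := C_AbsRing) (V := C_NormedModule) _ _ _ _ H Hd).
    replace (CPSeries a w - CPSeries a z - CPSeries (PS_derive a) z * (w - z))%C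
      with (CPSeries a w - CPSeries a z - (w - z) * CPSeries (PS_derive a) z)%C by ring.
    revert H'; apply is_series_ext; intros n.
    change ((Cterm a w n - Cterm a z n
     - (w - z) * match n with 0%nat => 0 | S m => Cterm (PS_derive a) z m end) = t n)%C.
    unfold t; destruct n; ring. }
  (* The remainders of the constant and linear terms vanish. *)
  assert (H2 : is_Cseries (fun n => t (S (S n)))
     (CPSeries a w - CPSeries a z - CPSeries (PS_derive a) z * (w - z))%C).
  { apply (is_series_incr_1 (K := C_AbsRing) (V := C_NormedModule) (fun n => t (S n))).
    apply (is_series_incr_1 (K := C_AbsRing) (V := C_NormedModule) t).
    match goal with |- is_series _ ?l => match type of Ht with is_series _ ?m =>
      replace l with m; [exact Ht|] end end.
    match goal with |- ?m = _ => change (m = m + t 1%nat + t 0%nat)%C end.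
    assert (t 0%nat = 0) as -> by (unfold t, Cterm; simpl; ring).
    assert (t 1%nat = 0) as ->.
    { unfold t, Cterm, PS_derive; simpl; rewrite RtoC_mult; ring. }
    ring. }
  rewrite Rmult_comm.
  apply (Cmod_series_le _ (fun n => Cmod (w - z) ^ 2 *
     Rabs (PS_derive (PS_derive a) n * r ^ n))) with (2 := H2).
  - intros n.
    replace (t (S (S n))) with (a (S (S n)) *
      (w ^ S (S n) - z ^ S (S n) - INR (S (S n)) * z ^ S n * (w - z)))%C.
    2:{ unfold t, Cterm, PS_derive; rewrite RtoC_mult; ring. }
    rewrite Cmod_mult, Cmod_R.
    unfold PS_derive.
    rewrite !Rabs_mult, (Rabs_pos_eq (INR _)), (Rabs_pos_eq (INR _)), (Rabs_pos_eq (r ^ n))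
      by first [apply pos_INR | now apply pow_le].
    assert (H := Cpow_taylor_le z w r n Hz Hw).
    apply (Rmult_le_compat_l (Rabs (a (S (S n))))) in H; [|apply Rabs_pos].
    apply Rle_trans with (1 := H); apply Req_le; ring.
  - apply (is_series_scal (K := R_AbsRing) (V := R_NormedModule)).
    apply Series_correct, CV_disk_inside.
    rewrite !CV_radius_derive, Rabs_pos_eq; assumption.
Qed.

Lemma is_derive_CPSeries (a : nat -> R) (z : C) :
  Rbar_lt (Cmod z) (CV_radius a) ->
  is_derive (K := C_AbsRing) (V := C_NormedModule) (CPSeries a) z
    (CPSeries (PS_derive a) z).
Proof.
  intros Hz.
  assert (exists r : R, Cmod z < r /\ Rbar_lt r (CV_radius a)) as (r & Hzr & Hr).
  { destruct (CV_radius a) as [c| |]; simpl in Hz; [| |easy].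
    - exists ((Cmod z + c) / 2); simpl; split; lra.
    - exists (Cmod z + 1); simpl; split; [lra|easy]. }
  set (M := Series (fun n => Rabs (PS_derive (PS_derive a) n * r ^ n))).
  split; [apply is_linear_scal_l|].
  intros y Hy eps.
  apply (is_filter_lim_locally_unique (K := C_AbsRing)
    (V := AbsRing_NormedModule C_AbsRing)) in Hy; subst y.
  assert (Hd : 0 < Rmin (r - Cmod z) (eps / (Rabs M + 1))).
  { assert (HM := Rabs_pos M).
    apply Rmin_pos; [lra|apply Rdiv_lt_0_compat; [apply cond_pos|lra]]. }
  exists (mkposreal _ Hd); intros w Hw.
  change (Cmod (w - z) < Rmin (r - Cmod z) (eps / (Rabs M + 1))) in Hw.
  change (Cmod (CPSeries a w - CPSeries a z - (w - z) * CPSeries (PS_derive a) z)%C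
     <= eps * Cmod (w - z)).
  assert (Hw1 := Rlt_le_trans _ _ _ Hw (Rmin_l _ _)).
  assert (Hw2 := Rlt_le_trans _ _ _ Hw (Rmin_r _ _)).
  replace (CPSeries a w - CPSeries a z - (w - z) * CPSeries (PS_derive a) z)%C
    with (CPSeries a w - CPSeries a z - CPSeries (PS_derive a) z * (w - z))%C by ring.
  eapply Rle_trans; [apply (CPSeries_taylor_le a r)|].
  - lra.
  - replace w with (z + (w - z))%C by ring.
    apply Rle_trans with (1 := Cmod_triangle _ _); lra.
  - exact Hr.
  - fold M.
    assert (H0 := Cmod_ge_0 (w - z)); assert (H1 := Rle_abs M); assert (H2 := Rabs_pos M).
    apply Rle_trans with ((Rabs M + 1) * Cmod (w - z) * Cmod (w - z)).
    + replace (M * Cmod (w - z) ^ 2) with (M * (Cmod (w - z) * Cmod (w - z))) by ring.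
      rewrite Rmult_assoc; apply Rmult_le_compat_r; nra.
    + apply Rmult_le_compat_r; [exact H0|].
      apply Rlt_le; apply (Rmult_lt_compat_l (Rabs M + 1)) in Hw2; [|lra].
      replace (pos eps) with ((Rabs M + 1) * (eps / (Rabs M + 1))) by (field; lra); lra.
Qed.

(** * Bloch norms of power series on the unit disk *)
Lemma CV_radius_ge_1 (a : nat -> R) (M : R) :
  (forall n, Rabs (a n) <= M) -> Rbar_le 1 (CV_radius a).
Proof.
  intros H; apply (proj1 (CV_radius_bounded a)); exists M; intros n.
  rewrite pow1, Rmult_1_r; apply H.
Qed.

Lemma disk_lt_radius (a : nat -> R) (r : R) :
  Rbar_le 1 (CV_radius a) -> r < 1 -> Rbar_lt r (CV_radius a).
Proof. intros Ha Hr; apply Rbar_lt_le_trans with (2 := Ha); exact Hr. Qed.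

Lemma C_derive_CPSeries (a : nat -> R) (z : C) :
  Rbar_lt (Cmod z) (CV_radius a) ->
  C_derive (CPSeries a) z = CPSeries (PS_derive a) z.
Proof. intros H; now apply is_C_derive_unique, is_derive_CPSeries. Qed.

Lemma analytic_CPSeries (a : nat -> R) :
  Rbar_le 1 (CV_radius a) -> analytic_in_disk (CPSeries a).
Proof.
  intros Ha z Hz; exists (CPSeries (PS_derive a) z).
  now apply is_derive_CPSeries, disk_lt_radius.
Qed.

Lemma is_hilbert_CPSeries (a b : nat -> R) :
  Rbar_le 1 (CV_radius a) -> Rbar_le 1 (CV_radius b) ->
  (forall n, is_series (fun k => a k / INR (n + k + 1)) (b n)) ->
  is_hilbert (CPSeries a) (CPSeries b).
Proof.
  intros Ha Hb Hab.
  exists (fun n => RtoC (a n)), (fun n => RtoC (b n)); repeat split.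
  - intros z Hz; now apply CPSeries_correct, disk_lt_radius.
  - intros n; generalize (is_Cseries_RtoC _ _ (Hab n)); apply is_series_ext.
    intros k; apply RtoC_div; rewrite Nat.add_1_r; apply not_0_INR; discriminate.
  - intros z Hz; now apply CPSeries_correct, disk_lt_radius.
  - now apply analytic_CPSeries.
Qed.

(** Evaluation at a single point: the source of every lower bound for a
    weighted norm, both at the origin and near the boundary. *)
Lemma weighted_norm_ge (w : R -> R) (f : C -> C) (z : C) :
  in_disk z ->
  Rbar_le (Cmod (f (RtoC 0)) + w (Cmod z) * Cmod (C_derive f z)) (weighted_norm w f).
Proof.
  intros Hz; unfold weighted_norm.
  match goal with |- Rbar_le _ (Rbar_plus _ (Lub_Rbar ?E)) =>
    assert (H : Rbar_le (w (Cmod z) * Cmod (C_derive f z)) (Lub_Rbar E));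
    [apply (proj1 (Lub_Rbar_correct E)); now exists z|];
    destruct (Lub_Rbar E); simpl in *; lra || easy
  end.
Qed.

Lemma weighted_norm_le (w : R -> R) (f : C -> C) (M : R) :
  (forall z, in_disk z -> w (Cmod z) * Cmod (C_derive f z) <= M) ->
  Rbar_le (weighted_norm w f) (Cmod (f (RtoC 0)) + M).
Proof.
  intros HM; unfold weighted_norm.
  match goal with |- Rbar_le (Rbar_plus _ (Lub_Rbar ?E)) _ =>
    assert (H : Rbar_le (Lub_Rbar E) M);
    [apply (proj2 (Lub_Rbar_correct E)); intros x (z & Hz & ->); now apply HM|];
    destruct (Lub_Rbar E); simpl in *; lra || easy
  end.
Qed.

Lemma bloch_weight_pos (alpha r : R) : 0 < bloch_weight alpha r.
Proof. apply exp_pos. Qed.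

Lemma bloch_norm_CPSeries_le (alpha M : R) (a : nat -> R) :
  (forall n, 0 <= a n) -> Rbar_le 1 (CV_radius a) ->
  (forall r, 0 <= r < 1 -> bloch_weight alpha r * PSeries (PS_derive a) r <= M) ->
  Rbar_le (bloch_norm alpha (CPSeries a)) (a 0%nat + M).
Proof.
  intros Ha Hr HM.
  replace (a 0%nat) with (Cmod (CPSeries a (RtoC 0))).
  2:{ rewrite CPSeries_0 by (apply disk_lt_radius; [exact Hr|lra]).
      rewrite Cmod_R; now apply Rabs_pos_eq. }
  apply weighted_norm_le; intros z Hz.
  rewrite C_derive_CPSeries by now apply disk_lt_radius.
  eapply Rle_trans; [|apply (HM (Cmod z)); split; [apply Cmod_ge_0|exact Hz]].
  apply Rmult_le_compat_l; [apply Rlt_le, bloch_weight_pos|].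
  apply Cmod_CPSeries_le.
  - intros n; apply Rmult_le_pos; [apply pos_INR|apply Ha].
  - rewrite CV_radius_derive; now apply disk_lt_radius.
Qed.

Lemma in_bloch_CPSeries (alpha M : R) (a : nat -> R) :
  (forall n, 0 <= a n) -> Rbar_le 1 (CV_radius a) ->
  (forall r, 0 <= r < 1 -> bloch_weight alpha r * PSeries (PS_derive a) r <= M) ->
  in_bloch alpha (CPSeries a).
Proof.
  intros Ha Hr HM; split; [now apply analytic_CPSeries|].
  eapply Rbar_le_lt_trans; [now apply bloch_norm_CPSeries_le with (M := M)|easy].
Qed.

(** * Power series with nonnegative coefficients at the boundary *)
Lemma sum_n_le_Series (u : nat -> R) (n : nat) :
  (forall k, 0 <= u k) -> ex_series u -> sum_n u n <= Series u.
Proof.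
  intros Hu Hex.
  apply (is_lim_seq_incr_compare (sum_n u)); [now apply Series_correct|].
  intros k; rewrite sum_Sn; assert (H := Hu (S k)); unfold plus; simpl; lra.
Qed.

Lemma PSeries_partial_le (c : nat -> R) (x : R) (n : nat) :
  (forall k, 0 <= c k) -> Rbar_le 1 (CV_radius c) -> 0 <= x < 1 ->
  sum_n (fun k => c k * x ^ k) n <= PSeries c x.
Proof.
  intros Hc Hr Hx; apply sum_n_le_Series.
  - intros k; apply Rmult_le_pos; [apply Hc|apply pow_le; lra].
  - assert (H : ex_pseries c x).
    { apply CV_radius_inside, disk_lt_radius; [exact Hr|].
      rewrite Rabs_pos_eq; lra. }
    exact (proj1 (ex_pseries_R _ _) H).
Qed.

Lemma continuous_sum_pow (c : nat -> R) (n : nat) (x : R) :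
  continuous (fun y => sum_n (fun k => c k * y ^ k) n) x.
Proof.
  induction n as [|n IH].
  - apply (continuous_ext (fun y => c 0%nat * y ^ 0)).
    { intros y; now rewrite sum_O. }
    simpl; apply continuous_const.
  - apply (continuous_ext (fun y => sum_n (fun k => c k * y ^ k) n + c (S n) * y ^ S n)).
    { intros y; now rewrite sum_Sn. }
    apply (continuous_plus (V := R_NormedModule)); [exact IH|].
    apply (ex_derive_continuous (V := R_NormedModule)); auto_derive; easy.
Qed.

(** Each partial sum is at most M on (0, 1), hence at 1 by continuity; so the
    partial sums at 1 increase and are bounded. *)
Lemma ex_series_of_bounded_PSeries (c : nat -> R) (M : R) :
  (forall k, 0 <= c k) -> Rbar_le 1 (CV_radius c) ->
  (forall x, 0 < x < 1 -> PSeries c x <= M) ->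
  ex_series c.
Proof.
  intros Hc Hr HM.
  assert (HS : forall n, sum_n c n <= M).
  { intros n.
    assert (L : filterlim (fun y => sum_n (fun k => c k * y ^ k) n) (at_left 1)
       (locally (sum_n c n))).
    { replace (sum_n c n) with (sum_n (fun k => c k * 1 ^ k) n).
      2:{ apply sum_n_ext; intros k; rewrite pow1; apply Rmult_1_r. }
      eapply filterlim_filter_le_1; [|apply continuous_sum_pow].
      intros P HP; now apply filter_le_within. }
    apply (filterlim_le (F := at_left 1) _ (fun _ => M) (sum_n c n) M) with (2 := L).
    - exists (mkposreal 1 Rlt_0_1); intros y Hy Hy1.
      change (Rabs (y - 1) < 1) in Hy; apply Rabs_lt_between in Hy.
      eapply Rle_trans; [apply PSeries_partial_le; auto; lra|apply HM; lra].
    - apply filterlim_const. }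
  destruct (ex_finite_lim_seq_incr (sum_n c) M) as [l Hl]; [|exact HS|now exists l].
  intros n; rewrite sum_Sn; assert (H := Hc (S n)); unfold plus; simpl; lra.
Qed.

(** The monotone case of Abel's theorem: on (0, 1) the series lies between its
    partial sums and its value at 1, and a partial sum close to that value at 1
    stays close to it nearby. *)
Lemma filterlim_PSeries_at_left_1 (c : nat -> R) :
  (forall k, 0 <= c k) -> Rbar_le 1 (CV_radius c) -> ex_series c ->
  filterlim (PSeries c) (at_left 1) (locally (Series c)).
Proof.
  intros Hc Hr Hex; apply filterlim_locally; intros eps.
  assert (HL := Series_correct _ Hex).
  destruct (HL _ (locally_ball (Series c) (pos_div_2 eps))) as [N HN].
  specialize (HN N (le_n N)); change (Rabs (sum_n c N - Series c) < eps / 2) in HN.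
  assert (L := continuous_sum_pow c N 1).
  assert (E : sum_n (fun k => c k * 1 ^ k) N = sum_n c N).
  { apply sum_n_ext; intros k; rewrite pow1; apply Rmult_1_r. }
  destruct (L _ (locally_ball _ (pos_div_2 eps))) as [d Hd].
  assert (Hd' : 0 < Rmin 1 d) by (apply Rmin_pos; [lra|apply cond_pos]).
  exists (mkposreal _ Hd'); intros x Hx Hx1.
  change (Rabs (x - 1) < Rmin 1 d) in Hx.
  assert (Hxd := Rlt_le_trans _ _ _ Hx (Rmin_r _ _)).
  assert (Hx0 := Rlt_le_trans _ _ _ Hx (Rmin_l _ _)).
  specialize (Hd x Hxd).
  change (Rabs (sum_n (fun k => c k * x ^ k) N - sum_n (fun k => c k * 1 ^ k) N)
    < eps / 2) in Hd; rewrite E in Hd.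
  apply Rabs_lt_between in Hx0; apply Rabs_lt_between in Hd; apply Rabs_lt_between in HN.
  assert (H1 := PSeries_partial_le c x N Hc Hr ltac:(lra)).
  assert (H2 : PSeries c x <= Series c).
  { apply Series_le; [|exact Hex]; intros n.
    assert (H3 : 0 <= x ^ n <= 1).
    { split; [apply pow_le; lra|]. rewrite <- (pow1 n); apply pow_incr; lra. }
    assert (H4 := Hc n); split; nra. }
  change (Rabs (PSeries c x - Series c) < eps); apply Rabs_lt_between.
  assert (He := cond_pos eps); lra.
Qed.

(** * The extremal function *)

(** Taylor coefficients of (1 - x^2)^(-beta), by the recursion that the
    differential equation (1 - x^2) y' = 2 beta x y imposes.  In this form it is
    visible that they lie in [0, 1] when beta does. *)
Fixpoint even_binom (beta : R) (n : nat) : R :=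
  match n with
  | 0%nat => 1
  | 1%nat => 0
  | S (S m) => (INR m + 2 * beta) / (INR m + 2) * even_binom beta m
  end.

Lemma even_binom_bounds (beta : R) (n : nat) :
  0 <= beta <= 1 -> 0 <= even_binom beta n <= 1.
Proof.
  intros Hb.
  enough (H : 0 <= even_binom beta n <= 1 /\ 0 <= even_binom beta (S n) <= 1) by apply H.
  induction n as [|n [IH1 IH2]]; [simpl; lra|]; split; [exact IH2|].
  change (even_binom beta (S (S n)))
    with ((INR n + 2 * beta) / (INR n + 2) * even_binom beta n).
  assert (Hn := pos_INR n).
  assert (Hq : 0 <= (INR n + 2 * beta) / (INR n + 2) <= 1).
  { split; [apply Rmult_le_pos; [lra|apply Rlt_le, Rinv_0_lt_compat; lra]|].
    apply Rmult_le_reg_r with (INR n + 2); [lra|].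
    unfold Rdiv; rewrite Rmult_assoc, Rinv_l by lra; lra. }
  split; nra.
Qed.

Lemma even_binom_radius (beta : R) :
  0 <= beta <= 1 -> Rbar_le 1 (CV_radius (even_binom beta)).
Proof.
  intros Hb; apply (CV_radius_ge_1 _ 1); intros n.
  assert (H := even_binom_bounds beta n Hb); rewrite Rabs_pos_eq; lra.
Qed.

Lemma PSeries_even_binom_ode (beta x : R) :
  0 <= beta <= 1 -> Rabs x < 1 ->
  (1 - x ^ 2) * PSeries (PS_derive (even_binom beta)) x
  = 2 * beta * x * PSeries (even_binom beta) x.
Proof.
  intros Hb Hx.
  set (y := even_binom beta).
  assert (Hr : Rbar_lt (Rabs x) (CV_radius (PS_derive y))).
  { rewrite CV_radius_derive; apply disk_lt_radius; [now apply even_binom_radius|exact Hx]. }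
  replace ((1 - x ^ 2) * PSeries (PS_derive y) x) with
    (PSeries (PS_derive y) x - PSeries (PS_incr_1 (PS_incr_1 (PS_derive y))) x)
    by (rewrite !PSeries_incr_1; ring).
  replace (2 * beta * x * PSeries y x) with (PSeries (PS_scal (2 * beta) (PS_incr_1 y)) x)
    by (rewrite PSeries_scal, PSeries_incr_1; ring).
  rewrite <- PSeries_minus.
  - apply PSeries_ext; intros [|[|n]].
    + unfold PS_minus, PS_plus, PS_opp, PS_scal, PS_derive, PS_incr_1, y;
      cbv [plus opp scal zero mult]; simpl; cbv [mult]; simpl; ring.
    + unfold PS_minus, PS_plus, PS_opp, PS_scal, PS_derive, PS_incr_1, y;
      cbv [plus opp scal zero mult]; simpl; cbv [mult]; simpl; field.
    + change (INR (S (S (S n))) * ((INR (S n) + 2 * beta) / (INR (S n) + 2) * y (S n))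
        + - (INR (S n) * y (S n)) = 2 * beta * y (S n)).
      assert (Hn := pos_INR n); rewrite !S_INR; field; lra.
  - now apply CV_radius_inside.
  - apply CV_radius_inside; now rewrite !CV_radius_incr_1.
Qed.

Lemma Rabs_lt_1_sqr (x : R) : Rabs x < 1 -> 0 < 1 - x ^ 2.
Proof. intros H; apply Rabs_lt_between in H; nra. Qed.

Lemma is_derive_Rpower_1_sub_sqr (p x : R) :
  Rabs x < 1 ->
  is_derive (fun t => Rpower (1 - t ^ 2) p) x (- 2 * p * x * Rpower (1 - x ^ 2) (p - 1)).
Proof.
  intros Hx.
  replace (- 2 * p * x * Rpower (1 - x ^ 2) (p - 1))
    with (scal (- 2 * x) (p * Rpower (1 - x ^ 2) (p - 1)))
    by (unfold scal; simpl; unfold mult; simpl; ring).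
  apply (is_derive_comp (fun u => Rpower u p) (fun t => 1 - t ^ 2)).
  - apply is_derive_Reals, derivable_pt_lim_power; now apply Rabs_lt_1_sqr.
  - auto_derive; [easy|ring].
Qed.

Lemma eq_of_is_derive_0 (h : R -> R) (x : R) :
  (forall t, 0 <= t < 1 -> is_derive h t 0) -> 0 <= x < 1 -> h x = h 0.
Proof.
  intros Hd Hx; destruct (Req_dec x 0) as [->|Hx0]; [reflexivity|].
  symmetry; apply (eq_is_derive h 0 x); [|lra].
  intros t Ht; apply Hd; lra.
Qed.

(** By the differential equation, y(x) (1 - x^2)^beta has derivative 0. *)
Lemma PSeries_even_binom (beta x : R) :
  0 <= beta <= 1 -> 0 <= x < 1 ->
  PSeries (even_binom beta) x = Rpower (1 - x ^ 2) (- beta).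
Proof.
  intros Hb Hx.
  assert (H : PSeries (even_binom beta) x * Rpower (1 - x ^ 2) beta = 1).
  { transitivity (PSeries (even_binom beta) 0 * Rpower (1 - 0 ^ 2) beta).
    2:{ rewrite PSeries_0; replace (1 - 0 ^ 2) with 1 by ring.
        unfold Rpower; rewrite ln_1, Rmult_0_r, exp_0; simpl; ring. }
    apply (eq_of_is_derive_0
      (fun t => PSeries (even_binom beta) t * Rpower (1 - t ^ 2) beta)); [|exact Hx].
    intros t Ht0; assert (Ht : Rabs t < 1) by (rewrite Rabs_pos_eq; lra).
    assert (H1 := is_derive_PSeries (even_binom beta) t
      (disk_lt_radius _ _ (even_binom_radius beta Hb) Ht)).
    assert (H2 := is_derive_Rpower_1_sub_sqr beta t Ht).
    assert (H3 := is_derive_mult _ _ _ _ _ H1 H2 Rmult_comm).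
    match type of H3 with is_derive _ _ ?l => replace 0 with l; [exact H3|] end.
    assert (H0 := Rabs_lt_1_sqr t Ht).
    assert (HP : Rpower (1 - t ^ 2) beta = (1 - t ^ 2) * Rpower (1 - t ^ 2) (beta - 1)).
    { rewrite <- (Rpower_1 (1 - t ^ 2)) at 2 by exact H0.
      rewrite <- Rpower_plus; f_equal; ring. }
    rewrite HP; unfold plus, mult; simpl plus; simpl.
    assert (HO := PSeries_even_binom_ode beta t Hb Ht); simpl in HO.
    set (P := Rpower _ (beta - 1)).
    replace (_ + _) with (P * ((1 - t * (t * 1)) * PSeries (PS_derive (even_binom beta)) t
      - 2 * beta * t * PSeries (even_binom beta) t)) by ring.
    rewrite HO; ring. }
  rewrite Rpower_Ropp; apply Rmult_eq_reg_r with (Rpower (1 - x ^ 2) beta).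
  - rewrite H, Rinv_l; [reflexivity|apply Rgt_not_eq, exp_pos].
  - apply Rgt_not_eq, exp_pos.
Qed.

(** Coefficients of f(x) = ((1 - x^2)^(-beta) - 1) / (2 beta), normalized so that
    f(0) = 0 and f'(x) = x (1 - x^2)^(-(beta + 1)). *)
Definition extremal_coef (beta : R) (n : nat) : R :=
  match n with 0%nat => 0 | S _ => even_binom beta n / (2 * beta) end.

Lemma extremal_bounds (beta : R) (n : nat) :
  0 < beta <= 1 -> 0 <= extremal_coef beta n <= / (2 * beta).
Proof.
  intros Hb; assert (Hi : 0 < / (2 * beta)) by (apply Rinv_0_lt_compat; lra).
  destruct n as [|n]; [simpl; lra|].
  assert (H := even_binom_bounds beta (S n) ltac:(lra)).
  unfold extremal_coef, Rdiv; split; nra.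
Qed.

Lemma extremal_radius (beta : R) :
  0 < beta <= 1 -> Rbar_le 1 (CV_radius (extremal_coef beta)).
Proof.
  intros Hb; apply (CV_radius_ge_1 _ (/ (2 * beta))); intros n.
  assert (H := extremal_bounds beta n Hb); rewrite Rabs_pos_eq; lra.
Qed.

Lemma PSeries_extremal (beta x : R) :
  0 < beta <= 1 -> 0 <= x < 1 ->
  PSeries (extremal_coef beta) x = (Rpower (1 - x ^ 2) (- beta) - 1) / (2 * beta).
Proof.
  intros Hb Hx; assert (Hxa : Rabs x < 1) by (rewrite Rabs_pos_eq; lra).
  rewrite <- PSeries_even_binom by lra.
  rewrite (PSeries_decr_1 (even_binom beta)), (PSeries_decr_1 (extremal_coef beta)).
  - rewrite (PSeries_ext (PS_decr_1 (extremal_coef beta))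
      (PS_scal (/ (2 * beta)) (PS_decr_1 (even_binom beta)))).
    + rewrite PSeries_scal; simpl; field; lra.
    + intros n; unfold PS_decr_1, PS_scal, extremal_coef, Rdiv; apply Rmult_comm.
  - apply CV_radius_inside, disk_lt_radius; [now apply extremal_radius|exact Hxa].
  - apply CV_radius_inside, disk_lt_radius; [apply even_binom_radius; lra|exact Hxa].
Qed.

Lemma PSeries_derive_extremal (beta x : R) :
  0 < beta <= 1 -> 0 <= x < 1 ->
  PSeries (PS_derive (extremal_coef beta)) x = x * Rpower (1 - x ^ 2) (- (beta + 1)).
Proof.
  intros Hb Hx; assert (Hxa : Rabs x < 1) by (rewrite Rabs_pos_eq; lra).
  assert (H0 := Rabs_lt_1_sqr x Hxa).
  rewrite (PSeries_ext _ (PS_scal (/ (2 * beta)) (PS_derive (even_binom beta)))).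
  2:{ intros n; unfold PS_derive, PS_scal, extremal_coef, Rdiv, scal; simpl; unfold mult; simpl.
      ring. }
  rewrite PSeries_scal.
  assert (HO := PSeries_even_binom_ode beta x ltac:(lra) Hxa).
  rewrite PSeries_even_binom in HO by lra.
  apply Rmult_eq_reg_l with (1 - x ^ 2); [|lra].
  replace (Rpower (1 - x ^ 2) (- beta)) with
    ((1 - x ^ 2) * Rpower (1 - x ^ 2) (- (beta + 1))) in HO.
  2:{ rewrite <- (Rpower_1 (1 - x ^ 2)) at 1 by exact H0.
      rewrite <- Rpower_plus; f_equal; ring. }
  rewrite <- Rmult_assoc, (Rmult_comm (1 - x ^ 2)), Rmult_assoc, HO; field; lra.
Qed.

Lemma is_derive_PSeries_Int (a : nat -> R) (x : R) :
  Rbar_lt (Rabs x) (CV_radius a) -> is_derive (PSeries (PS_Int a)) x (PSeries a x).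
Proof.
  intros Hx; rewrite (PSeries_ext a (PS_derive (PS_Int a))).
  - apply is_derive_PSeries; now rewrite CV_radius_Int.
  - intros n; unfold PS_derive, PS_Int; field; apply not_0_INR; discriminate.
Qed.

(** The power series is the integral of t f(t) from 0 to x, which is elementary
    because t (1 - t^2)^(-beta) has an elementary primitive. *)
Lemma PSeries_first_moment_extremal (beta x : R) :
  0 < beta < 1 -> 0 <= x < 1 ->
  PSeries (PS_Int (PS_incr_1 (extremal_coef beta))) x
  = ((1 - Rpower (1 - x ^ 2) (1 - beta)) / (2 * (1 - beta)) - x ^ 2 / 2) / (2 * beta).
Proof.
  intros Hb Hx.
  assert (Hr : Rbar_le 1 (CV_radius (PS_incr_1 (extremal_coef beta)))).
  { rewrite CV_radius_incr_1; apply extremal_radius; lra. }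
  set (c := PS_Int _).
  set (G := fun t =>
    ((1 - Rpower (1 - t ^ 2) (1 - beta)) / (2 * (1 - beta)) - t ^ 2 / 2) / (2 * beta)).
  enough (H : PSeries c x - G x = PSeries c 0 - G 0).
  { assert (H1 : PSeries c 0 = 0) by (now rewrite PSeries_0).
    assert (H2 : G 0 = 0).
    { unfold G; replace (1 - 0 ^ 2) with 1 by ring.
      unfold Rpower; rewrite ln_1, Rmult_0_r, exp_0; field; lra. }
    fold (G x); lra. }
  apply (eq_of_is_derive_0 (fun t => PSeries c t - G t)); [|exact Hx].
  intros t Ht; assert (Hta : Rabs t < 1) by (rewrite Rabs_pos_eq; lra).
  assert (H1 : is_derive (PSeries c) t (t * PSeries (extremal_coef beta) t)).
  { rewrite <- PSeries_incr_1; apply is_derive_PSeries_Int.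
    now apply disk_lt_radius. }
  rewrite PSeries_extremal in H1 by lra.
  assert (H2 : is_derive G t (t * ((Rpower (1 - t ^ 2) (- beta) - 1) / (2 * beta)))).
  { assert (HR := is_derive_Rpower_1_sub_sqr (1 - beta) t Hta).
    replace (1 - beta - 1) with (- beta) in HR by ring.
    assert (Hlin : forall P d, is_derive P t d ->
      is_derive (fun u => ((1 - P u) / (2 * (1 - beta)) - u ^ 2 / 2) / (2 * beta)) t
        ((- d / (2 * (1 - beta)) - t) / (2 * beta))).
    { intros P d HP; auto_derive; [now exists d|].
      replace (Derive (fun x => P x) t) with d
        by (symmetry; apply is_derive_unique, HP).
      field; lra. }
    apply Hlin in HR; unfold G.
    match type of HR with is_derive _ _ ?l => match goal with |- is_derive _ _ ?m =>
      replace m with l; [exact HR|field; lra] end end. }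
  assert (H3 := is_derive_minus _ _ _ _ _ H1 H2).
  match type of H3 with is_derive _ _ ?l => match goal with |- is_derive _ _ ?m =>
    replace m with l; [exact H3|] end end.
  apply Rminus_diag_eq; reflexivity.
Qed.

(** * The Hilbert matrix on nonnegative coefficients *)
Definition hilbert_coef (a : nat -> R) (n : nat) : R :=
  Series (fun k => a k / INR (n + k + 1)).

Lemma INR_add_1_pos (n k : nat) : 0 < INR (n + k + 1).
Proof. apply lt_0_INR; lia. Qed.

Lemma hilbert_term_le (a : nat -> R) (n k : nat) :
  0 <= a k -> 0 <= a k / INR (n + k + 1) <= a k / INR (S k).
Proof.
  intros Ha; split.
  - apply Rmult_le_pos; [exact Ha|apply Rlt_le, Rinv_0_lt_compat, INR_add_1_pos].
  - apply Rmult_le_compat_l; [exact Ha|apply Rinv_le_contravar].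
    + apply lt_0_INR; lia.
    + apply le_INR; lia.
Qed.

Lemma is_series_hilbert_coef (a : nat -> R) (n : nat) :
  (forall k, 0 <= a k) -> ex_series (fun k => a k / INR (S k)) ->
  is_series (fun k => a k / INR (n + k + 1)) (hilbert_coef a n).
Proof.
  intros Ha Hex; apply Series_correct.
  apply (ex_series_le (V := R_CompleteNormedModule) _ (fun k => a k / INR (S k)));
    [|exact Hex].
  intros k; assert (H := hilbert_term_le a n k (Ha k)).
  change (Rabs (a k / INR (n + k + 1)) <= a k / INR (S k)).
  rewrite Rabs_pos_eq; apply H.
Qed.

(** The first row of the Hilbert matrix dominates the others; the coefficients
    of the image are thus bounded, and its power series converges on the disk. *)
Lemma hilbert_coef_bounds (a : nat -> R) (n : nat) :
  (forall k, 0 <= a k) -> ex_series (fun k => a k / INR (S k)) ->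
  0 <= hilbert_coef a n <= Series (fun k => a k / INR (S k)).
Proof.
  intros Ha Hex; split.
  - replace 0 with (Series (fun _ : nat => 0)).
    + apply Series_le; [|eexists; now apply is_series_hilbert_coef].
      intros k; split; [lra|now apply hilbert_term_le].
    + transitivity (PSeries (fun _ => 0) 0); [|apply PSeries_const_0].
      apply Series_ext; intros k; ring.
  - apply Series_le; [|exact Hex]; intros k; now apply hilbert_term_le.
Qed.

Lemma hilbert_coef_radius (a : nat -> R) :
  (forall k, 0 <= a k) -> ex_series (fun k => a k / INR (S k)) ->
  Rbar_le 1 (CV_radius (hilbert_coef a)).
Proof.
  intros Ha Hex; apply (CV_radius_ge_1 _ (Series (fun k => a k / INR (S k)))).
  intros n; assert (H := hilbert_coef_bounds a n Ha Hex); rewrite Rabs_pos_eq; lra.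
Qed.

Lemma is_hilbert_nonneg (a : nat -> R) :
  (forall k, 0 <= a k) -> Rbar_le 1 (CV_radius a) ->
  ex_series (fun k => a k / INR (S k)) ->
  is_hilbert (CPSeries a) (CPSeries (hilbert_coef a)).
Proof.
  intros Ha Hr Hex; apply is_hilbert_CPSeries; [exact Hr|now apply hilbert_coef_radius|].
  intros n; now apply is_series_hilbert_coef.
Qed.

(** Evaluation at the origin, where the logarithmic weight is 1. *)
Lemma bloch_log_norm_hilbert_ge (alpha : R) (a : nat -> R) :
  (forall k, 0 <= a k) -> ex_series (fun k => a k / INR (S k)) ->
  Rbar_le (hilbert_coef a 0 + hilbert_coef a 1)
    (bloch_log_norm alpha (CPSeries (hilbert_coef a))).
Proof.
  intros Ha Hex.
  assert (Hr := hilbert_coef_radius a Ha Hex).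
  assert (Hr0 : Rbar_lt 0 (CV_radius (hilbert_coef a)))
    by (apply disk_lt_radius; [exact Hr|lra]).
  replace (hilbert_coef a 0 + hilbert_coef a 1) with
    (Cmod (CPSeries (hilbert_coef a) (RtoC 0)) + bloch_log_weight alpha (Cmod (RtoC 0))
       * Cmod (C_derive (CPSeries (hilbert_coef a)) (RtoC 0))).
  - apply weighted_norm_ge; unfold in_disk; rewrite Cmod_0; lra.
  - rewrite C_derive_CPSeries by now rewrite Cmod_0.
    rewrite !CPSeries_0 by now rewrite ?CV_radius_derive.
    rewrite Cmod_0, !Cmod_R, (Rabs_pos_eq (hilbert_coef a 0)) by now apply hilbert_coef_bounds.
    unfold PS_derive; simpl (INR 1); rewrite Rmult_1_l.
    rewrite (Rabs_pos_eq (hilbert_coef a 1)) by now apply hilbert_coef_bounds.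
    unfold bloch_log_weight; replace (exp 1 / (1 - 0) ^ 2) with (exp 1) by field.
    replace (1 - 0 ^ 2) with 1 by ring.
    unfold Rpower; rewrite ln_exp, ln_1, Rmult_0_r, exp_0; field.
Qed.

(** * The first two Hilbert coefficients of the extremal function *)
Lemma filterlim_Rpower_1_sub_sqr (p : R) :
  0 < p -> filterlim (fun x => Rpower (1 - x ^ 2) p) (at_left 1) (locally 0).
Proof.
  intros Hp; apply filterlim_locally; intros eps.
  assert (Hq : 0 < Rpower eps (/ p)) by apply exp_pos.
  assert (Hd : 0 < Rmin 1 (Rpower eps (/ p) / 2)) by (apply Rmin_pos; lra).
  exists (mkposreal _ Hd); intros x Hx Hx1.
  change (Rabs (x - 1) < Rmin 1 (Rpower eps (/ p) / 2)) in Hx.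
  assert (Hx2 := Rlt_le_trans _ _ _ Hx (Rmin_l _ _)).
  assert (Hx3 := Rlt_le_trans _ _ _ Hx (Rmin_r _ _)).
  apply Rabs_lt_between in Hx2; apply Rabs_lt_between in Hx3.
  change (Rabs (Rpower (1 - x ^ 2) p - 0) < eps).
  rewrite Rminus_0_r, Rabs_pos_eq by apply Rlt_le, exp_pos.
  replace (pos eps) with (Rpower (Rpower eps (/ p)) p).
  - apply Rlt_Rpower_l; [exact Hp|]; split; nra.
  - rewrite Rpower_mult, Rinv_l by lra; apply Rpower_1, cond_pos.
Qed.

Lemma at_left_1_pos (P : R -> Prop) :
  (forall x, 0 < x < 1 -> P x) -> at_left 1 P.
Proof.
  intros HP; exists (mkposreal 1 Rlt_0_1); intros x Hx Hx1.
  change (Rabs (x - 1) < 1) in Hx; apply Rabs_lt_between in Hx; apply HP; lra.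
Qed.

Lemma filterlim_lin_comb (F : (R -> Prop) -> Prop) (FF : Filter F)
  (u v : R -> R) (lu lv p q r : R) :
  filterlim u F (locally lu) -> filterlim v F (locally lv) ->
  filterlim (fun x => p * u x + q * v x + r) F (locally (p * lu + q * lv + r)).
Proof.
  intros Hu Hv.
  assert (Hp := filterlim_comp _ _ _ _ _ _ _ _ Hu
    (filterlim_scal_r (V := R_NormedModule) p lu)).
  assert (Hq := filterlim_comp _ _ _ _ _ _ _ _ Hv
    (filterlim_scal_r (V := R_NormedModule) q lv)).
  assert (H := filterlim_comp_2 _ _ _ Hp Hq
    (filterlim_plus (V := R_NormedModule) _ _)).
  exact (filterlim_comp_2 _ _ _ H (filterlim_const r)
    (filterlim_plus (V := R_NormedModule) _ _)).
Qed.

Lemma filterlim_pow_at_left_1 (n : nat) :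
  filterlim (fun x => x ^ n) (at_left 1) (locally 1).
Proof.
  assert (H : continuous (fun x => x ^ n) 1).
  { apply (ex_derive_continuous (V := R_NormedModule)); auto_derive; easy. }
  unfold continuous in H; rewrite pow1 in H.
  intros P HP; now apply filter_le_within, H.
Qed.

Lemma first_moment_coef_nonneg (beta : R) (k : nat) :
  0 < beta < 1 -> 0 <= PS_Int (PS_incr_1 (extremal_coef beta)) k.
Proof.
  intros Hb; destruct k as [|[|k]]; simpl PS_Int; [lra|unfold zero; simpl; lra|].
  apply Rmult_le_pos; [apply extremal_bounds; lra|].
  apply Rlt_le, Rinv_0_lt_compat, (lt_0_INR (S (S k))); lia.
Qed.

Lemma ex_series_first_moment (beta : R) :
  0 < beta < 1 -> ex_series (PS_Int (PS_incr_1 (extremal_coef beta))).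
Proof.
  intros Hb.
  apply (ex_series_of_bounded_PSeries _ (1 / (2 * (1 - beta)) / (2 * beta))).
  - intros k; now apply first_moment_coef_nonneg.
  - rewrite CV_radius_Int, CV_radius_incr_1; apply extremal_radius; lra.
  - intros x Hx; rewrite PSeries_first_moment_extremal by lra.
    apply Rmult_le_compat_r; [apply Rlt_le, Rinv_0_lt_compat; lra|].
    assert (HP : 0 < Rpower (1 - x ^ 2) (1 - beta)) by apply exp_pos.
    assert (H : (1 - Rpower (1 - x ^ 2) (1 - beta)) / (2 * (1 - beta))
       <= 1 / (2 * (1 - beta))).
    { apply Rmult_le_compat_r; [apply Rlt_le, Rinv_0_lt_compat; lra|lra]. }
    nra.
Qed.

(** Follows from the elementary integral of t f(t), since
    1 / (k + 1) <= 2 / (k + 2). *)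
Lemma ex_series_extremal (beta : R) :
  0 < beta < 1 -> ex_series (fun k => extremal_coef beta k / INR (S k)).
Proof.
  intros Hb; assert (H := ex_series_first_moment beta Hb).
  apply (proj1 (ex_series_incr_1 _)), (proj1 (ex_series_incr_1 _)) in H.
  apply (ex_series_scal 2) in H.
  apply (ex_series_le (V := R_CompleteNormedModule)) with (2 := H); intros k.
  change (Rabs (extremal_coef beta k / INR (S k)) <= 2 * (extremal_coef beta k / INR (S (S k)))).
  assert (Ha := extremal_bounds beta k ltac:(lra)); assert (Hk := pos_INR k).
  rewrite Rabs_pos_eq.
  2:{ apply Rmult_le_pos; [lra|apply Rlt_le, Rinv_0_lt_compat, lt_0_INR; lia]. }
  rewrite !S_INR.
  apply Rle_trans with (extremal_coef beta k * (2 / (INR k + 1 + 1))); [|right; field; lra].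
  apply Rmult_le_compat_l; [lra|].
  apply Rmult_le_reg_r with ((INR k + 1) * (INR k + 1 + 1)); [nra|].
  field_simplify; lra.
Qed.

(** The coefficient is the value at 1 of the series of the integrals of t f(t),
    hence the limit of the closed form of those integrals. *)
Lemma hilbert_coef_extremal_1 (beta : R) :
  0 < beta < 1 -> hilbert_coef (extremal_coef beta) 1 = 1 / (4 * (1 - beta)).
Proof.
  intros Hb; set (c := PS_Int (PS_incr_1 (extremal_coef beta))).
  assert (Hex : ex_series c) by now apply ex_series_first_moment.
  transitivity (Series c).
  - rewrite (Series_incr_1 c Hex), Series_incr_1 by apply (proj1 (ex_series_incr_1 c) Hex).
    unfold hilbert_coef; replace (c 0%nat) with 0 by reflexivity.
    replace (c 1%nat) with 0 by (unfold c; simpl; unfold zero; simpl; field).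
    rewrite !Rplus_0_l; apply Series_ext; intros k.
    unfold c; simpl PS_Int; now rewrite Nat.add_1_r.
  - apply (filterlim_locally_unique (F := at_left 1) (V := R_NormedModule) (PSeries c)).
    + apply filterlim_PSeries_at_left_1; [|  |exact Hex].
      * intros k; now apply first_moment_coef_nonneg.
      * unfold c; rewrite CV_radius_Int, CV_radius_incr_1; apply extremal_radius; lra.
    + apply (filterlim_ext_loc (fun x =>
        - / (4 * beta * (1 - beta)) * Rpower (1 - x ^ 2) (1 - beta)
        + - / (4 * beta) * x ^ 2 + / (4 * beta * (1 - beta)))).
      { apply at_left_1_pos; intros x Hx; unfold c.
        rewrite PSeries_first_moment_extremal by lra; field; lra. }
      replace (1 / (4 * (1 - beta))) with
        (- / (4 * beta * (1 - beta)) * 0 + - / (4 * beta) * 1 + / (4 * beta * (1 - beta)))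
        by (field; lra).
      apply filterlim_lin_comb; [typeclasses eauto| |apply filterlim_pow_at_left_1].
      apply filterlim_Rpower_1_sub_sqr; lra.
Qed.

(** Integrating (1 - t^2)^(-beta) = 2 beta f(t) + 1 termwise up to x < 1 gives
    a power series whose value at 1 is the zeroth Hilbert coefficient. *)
Lemma is_RInt_gen_extremal (beta : R) :
  0 < beta < 1 ->
  is_RInt_gen (fun t => Rpower (1 - t ^ 2) (- beta)) (at_point 0) (at_left 1)
    (2 * beta * hilbert_coef (extremal_coef beta) 0 + 1).
Proof.
  intros Hb; set (a := extremal_coef beta).
  assert (Hr : Rbar_le 1 (CV_radius a)) by (apply extremal_radius; lra).
  assert (Hex : ex_series (PS_Int a)).
  { apply (proj2 (ex_series_incr_1 _)); now apply ex_series_extremal. }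
  assert (HS : Series (PS_Int a) = hilbert_coef a 0).
  { rewrite (Series_incr_1 _ Hex); unfold hilbert_coef; simpl (PS_Int a 0).
    rewrite Rplus_0_l; apply Series_ext; intros k; simpl PS_Int.
    now rewrite Nat.add_0_l, Nat.add_1_r. }
  assert (HI : forall x, 0 < x < 1 ->
    is_RInt (fun t => Rpower (1 - t ^ 2) (- beta)) 0 x
      (2 * beta * PSeries (PS_Int a) x + x)).
  { intros x Hx.
    assert (H1 : is_RInt (PSeries a) 0 x (PSeries (PS_Int a) x)).
    { apply is_RInt_PSeries, disk_lt_radius; [exact Hr|rewrite Rabs_pos_eq; lra]. }
    apply (is_RInt_scal _ _ _ (2 * beta)) in H1.
    assert (H2 := is_RInt_const 0 x 1).
    assert (H3 := is_RInt_plus _ _ _ _ _ _ H1 H2).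
    replace (2 * beta * PSeries (PS_Int a) x + x) with
      (plus (scal (2 * beta) (PSeries (PS_Int a) x)) (scal (x - 0) 1)).
    2:{ unfold plus, scal; simpl; unfold mult; simpl; ring. }
    apply (is_RInt_ext (V := R_NormedModule)) with (2 := H3).
    rewrite Rmin_left, Rmax_right by lra; intros t Ht.
    change (2 * beta * PSeries a t + 1 = Rpower (1 - t ^ 2) (- beta)).
    unfold a; rewrite PSeries_extremal by lra; field; lra. }
  assert (HL : filterlim (fun x => 2 * beta * PSeries (PS_Int a) x + 1 * x ^ 1 + 0)
    (at_left 1) (locally (2 * beta * hilbert_coef a 0 + 1 * 1 + 0))).
  { rewrite <- HS.
    apply filterlim_lin_comb; [typeclasses eauto| |apply filterlim_pow_at_left_1].
    apply filterlim_PSeries_at_left_1; [|now rewrite CV_radius_Int|exact Hex].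
    intros [|k]; simpl; [lra|].
    apply Rmult_le_pos; [apply extremal_bounds; lra|].
    apply Rlt_le, Rinv_0_lt_compat, (lt_0_INR (S k)); lia. }
  rewrite Rmult_1_l, Rplus_0_r in HL.
  intros P HP; specialize (HL P HP).
  apply (Filter_prod _ _ _ (fun y => y = 0)
    (fun x => 0 < x < 1 /\ P (2 * beta * PSeries (PS_Int a) x + 1 * x ^ 1 + 0))).
  - reflexivity.
  - apply filter_and; [apply at_left_1_pos; auto|exact HL].
  - intros y x -> [Hx HPx]; eexists; split; [exact (HI x Hx)|].
    now rewrite pow_1, Rmult_1_l, Rplus_0_r in HPx.
Qed.

(** * Lower bound for the norm *)

(** A function of Bloch norm at most 1 bounds the operator norm from below by
    the norm of its image, which the origin bounds from below.  The point x
    makes the function nonzero and its norm positive, as the quotient needs.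
    The image may have infinite norm; the quotient is then infinite too. *)
Lemma hilbert_norm_ge (alpha : R) (a : nat -> R) :
  (forall k, 0 <= a k) -> Rbar_le 1 (CV_radius a) ->
  ex_series (fun k => a k / INR (S k)) -> a 0%nat = 0 ->
  (forall r, 0 <= r < 1 -> bloch_weight alpha r * PSeries (PS_derive a) r <= 1) ->
  (exists x, 0 < x < 1 /\ 0 < PSeries a x /\ 0 < PSeries (PS_derive a) x) ->
  Rbar_le (hilbert_coef a 0 + hilbert_coef a 1) (hilbert_norm alpha).
Proof.
  intros Ha Hr Hex Ha0 Hw (x & Hx & Hfx & Hdx).
  assert (Hle := bloch_norm_CPSeries_le alpha 1 a Ha Hr Hw).
  rewrite Ha0, Rplus_0_l in Hle.
  assert (Hdisk : in_disk (RtoC x)) by (unfold in_disk; rewrite Cmod_R, Rabs_pos_eq; lra).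
  assert (Hrx : Rbar_lt (Rabs x) (CV_radius a)).
  { apply disk_lt_radius; [exact Hr|rewrite Rabs_pos_eq; lra]. }
  assert (Hgt : Rbar_lt 0 (bloch_norm alpha (CPSeries a))).
  { eapply Rbar_lt_le_trans; [|apply (weighted_norm_ge _ _ (RtoC x)), Hdisk].
    rewrite C_derive_CPSeries, (CPSeries_RtoC (PS_derive a))
      by (rewrite ?Cmod_R, ?CV_radius_derive; exact Hrx).
    rewrite !Cmod_R, (Rabs_pos_eq (PSeries (PS_derive a) x)) by lra.
    apply Rplus_le_lt_0_compat; [apply Cmod_ge_0|].
    apply Rmult_lt_0_compat; [apply bloch_weight_pos|exact Hdx]. }
  assert (Hg := bloch_log_norm_hilbert_ge alpha a Ha Hex).
  assert (H0 := hilbert_coef_bounds a 0 Ha Hex).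
  assert (H1 := hilbert_coef_bounds a 1 Ha Hex).
  eapply Rbar_le_trans with
    (Rbar_div (bloch_log_norm alpha (CPSeries (hilbert_coef a))) (bloch_norm alpha (CPSeries a))).
  - set (L := hilbert_coef a 0 + hilbert_coef a 1) in *.
    assert (HL : 0 <= L) by (unfold L; lra).
    destruct (bloch_norm alpha (CPSeries a)) as [s| |]; simpl in Hle, Hgt; try easy.
    assert (Hs : 1 <= / s) by (rewrite <- Rinv_1; apply Rinv_le_contravar; lra).
    destruct (bloch_log_norm alpha (CPSeries (hilbert_coef a))) as [t| |]; simpl in Hg; [| |easy].
    + simpl; nra.
    + unfold Rbar_div; simpl Rbar_inv; unfold Rbar_mult; simpl.
      destruct (Rle_dec 0 (/ s)) as [h|h]; [|lra].
      destruct (Rle_lt_or_eq_dec 0 (/ s) h); [easy|lra].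
  - apply (proj1 (proj2_sig (Rbar_ex_lub _))).
    exists (CPSeries a), (CPSeries (hilbert_coef a)).
    split; [now apply in_bloch_CPSeries with (M := 1)|].
    split; [|split; [now apply is_hilbert_nonneg|reflexivity]].
    exists (RtoC x); split; [exact Hdisk|].
    rewrite CPSeries_RtoC by exact Hrx; intros E; apply RtoC_inj in E; lra.
Qed.

Lemma bloch_weight_extremal_le (alpha r : R) :
  1 < alpha < 2 -> 0 <= r < 1 ->
  bloch_weight alpha r * PSeries (PS_derive (extremal_coef (alpha - 1))) r <= 1.
Proof.
  intros Hal Hr; rewrite PSeries_derive_extremal by lra.
  replace (- (alpha - 1 + 1)) with (- alpha) by ring.
  unfold bloch_weight.
  replace (Rpower (1 - r ^ 2) alpha * (r * Rpower (1 - r ^ 2) (- alpha))) with r; [lra|].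
  rewrite (Rmult_comm r), <- Rmult_assoc, <- Rpower_plus, Rplus_opp_r.
  unfold Rpower; rewrite Rmult_0_l, exp_0; ring.
Qed.

Lemma hilbert_norm_lower_bound (alpha : R) :
  1 < alpha < 2 ->
  Rbar_le
    (Finite
       (1 / (2 * (alpha - 1)) *
          RInt_gen (fun t : R => Rpower (1 - t ^ 2) (1 - alpha))
            (at_point 0) (at_left 1)
        + (3 * alpha - 5) / (4 * (alpha - 1) * (2 - alpha))))
    (hilbert_norm alpha).
Proof.
  intros Hal; set (beta := alpha - 1).
  assert (Hb : 0 < beta < 1) by (unfold beta; lra).
  assert (HI := is_RInt_gen_extremal beta Hb).
  replace (- beta) with (1 - alpha) in HI by (unfold beta; ring).
  rewrite (is_RInt_gen_unique (V := R_CompleteNormedModule) _ _ HI).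
  match goal with |- Rbar_le (Finite ?l) _ => replace l with
    (hilbert_coef (extremal_coef beta) 0 + hilbert_coef (extremal_coef beta) 1) end.
  2:{ rewrite hilbert_coef_extremal_1 by exact Hb.
      unfold beta in *; simpl; field; lra. }
  apply hilbert_norm_ge.
  - intros k; apply extremal_bounds; lra.
  - apply extremal_radius; lra.
  - now apply ex_series_extremal.
  - reflexivity.
  - intros r Hr; now apply bloch_weight_extremal_le.
  - exists (1 / 2); split; [lra|].
    assert (Hf : forall p, 0 < Rpower (1 - (1 / 2) ^ 2) p) by (intros; apply exp_pos).
    rewrite PSeries_derive_extremal, PSeries_extremal by lra.
    split; [|specialize (Hf (- (beta + 1))); lra].
    apply Rdiv_lt_0_compat; [|lra].
    assert (H : ln (1 - (1 / 2) ^ 2) < 0).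
    { rewrite <- ln_1; apply ln_increasing; lra. }
    assert (H2 := exp_ineq1 (- beta * ln (1 - (1 / 2) ^ 2))); unfold Rpower.
    assert (0 < - beta * ln (1 - (1 / 2) ^ 2)) by nra.
    specialize (H2 ltac:(lra)); lra.
Qed.

(** * Unboundedness for large and small exponents *)

(** Uniqueness of coefficients, obtained from the real identity theorem by
    restricting to the real diameter and taking real parts. *)
Lemma power_series_coef_Re (a : nat -> C) (c : nat -> R) (n : nat) :
  Rbar_le 1 (CV_radius c) -> power_series_in_disk a (CPSeries c) -> Re (a n) = c n.
Proof.
  intros Hc Ha.
  assert (HR : forall x, Rabs x < 1 -> is_pseries (fun k => Re (a k)) x (PSeries c x)).
  { intros x Hx.
    assert (H := Ha (RtoC x)); unfold in_disk in H; rewrite Cmod_R in H.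
    specialize (H Hx); apply is_Cseries_Re in H.
    rewrite CPSeries_RtoC in H by now apply disk_lt_radius.
    apply is_pseries_R; revert H; apply is_series_ext; intros k.
    change (Re (pow_n (K := C_Ring) (RtoC x) k * a k)%C = Re (a k) * x ^ k).
    now rewrite pow_n_Cpow, <- RtoC_pow, re_scal_l, Rmult_comm. }
  apply (PSeries_ext_recip (fun k => Re (a k)) c).
  - apply Rbar_lt_le_trans with (Rabs (1 / 2)).
    { simpl; rewrite Rabs_pos_eq; lra. }
    apply Rbar_not_lt_le; intros Hlt; apply (CV_disk_outside _ _ Hlt).
    assert (H : ex_series (fun k => Re (a k) * (1 / 2) ^ k)).
    { exists (PSeries c (1 / 2)); apply (proj1 (is_pseries_R _ _ _)), HR.
      rewrite Rabs_pos_eq; lra. }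
    exact (ex_series_lim_0 _ H).
  - apply disk_lt_radius; [exact Hc|lra].
  - exists (mkposreal 1 Rlt_0_1); intros x Hx.
    apply is_pseries_unique, HR.
    change (Rabs (x - 0) < 1) in Hx; now rewrite Rminus_0_r in Hx.
Qed.

(** The partial sums dominate log (n + 2), since log (1 + x) <= x. *)
Lemma harmonic_diverges : ~ ex_series (fun k => / INR (S k)).
Proof.
  intros Hex.
  assert (Hln : forall n, ln (INR (S (S n))) <= sum_n (fun k => / INR (S k)) n).
  { assert (Hstep : forall n, ln (INR (S (S n))) <= ln (INR (S n)) + / INR (S n)).
    { intros n; assert (Hn := lt_0_INR (S n) ltac:(lia)).
      assert (Hi := Rinv_0_lt_compat _ Hn).
      replace (INR (S (S n))) with (INR (S n) * (1 + / INR (S n))).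
      2:{ rewrite (S_INR (S n)); field; lra. }
      rewrite ln_mult by lra; apply Rplus_le_compat_l.
      rewrite <- (ln_exp (/ INR (S n))) at 2; apply ln_le; [lra|apply exp_ineq1_le]. }
    intros n; induction n as [|n IH].
    - assert (H : ln (INR 2) <= ln 1 + / INR 1) by exact (Hstep 0%nat).
      rewrite ln_1, Rplus_0_l in H.
      now rewrite sum_O.
    - rewrite sum_Sn; assert (H := Hstep (S n)).
      change (ln (INR (S (S (S n)))) <= sum_n (fun k => / INR (S k)) n + / INR (S (S n))).
      lra. }
  set (S := Series (fun k => / INR (S k))).
  destruct (INR_unbounded (exp S)) as [n Hn].
  assert (H1 := sum_n_le_Series (fun k => / INR (Datatypes.S k)) n
    (fun k => Rlt_le _ _ (Rinv_0_lt_compat _ (lt_0_INR (Datatypes.S k) ltac:(lia)))) Hex).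
  fold S in H1.
  assert (H2 : S < ln (INR (Datatypes.S (Datatypes.S n)))).
  { rewrite <- (ln_exp S); apply ln_increasing; [apply exp_pos|].
    rewrite !S_INR; lra. }
  specialize (Hln n); lra.
Qed.

Lemma PSeries_ones (x : R) : Rabs x < 1 -> PSeries (fun _ => 1) x = / (1 - x).
Proof.
  intros Hx; rewrite <- (Series_geom x Hx); apply Series_ext; intros n; ring.
Qed.

Lemma ones_radius : Rbar_le 1 (CV_radius (fun _ => 1)).
Proof. apply (CV_radius_ge_1 _ 1); intros n; rewrite Rabs_R1; lra. Qed.

Lemma PSeries_derive_ones (x : R) :
  Rabs x < 1 -> PSeries (PS_derive (fun _ => 1)) x = / (1 - x) ^ 2.
Proof.
  intros Hx.
  rewrite <- Derive_PSeries by (apply disk_lt_radius; [apply ones_radius|exact Hx]).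
  assert (H1 : 1 - x <> 0) by (apply Rabs_lt_between in Hx; lra).
  apply is_derive_unique, (is_derive_ext_loc (fun t => / (1 - t))).
  - assert (Hd : 0 < 1 - Rabs x) by lra.
    assert (Hin : forall t : R, Rabs (t - x) < 1 - Rabs x -> Rabs t < 1).
    { intros t Ht; assert (H := Rabs_triang (t - x) x).
      replace (t - x + x) with t in H by ring; lra. }
    exists (mkposreal _ Hd); intros t Ht; symmetry; apply PSeries_ones, Hin, Ht.
  - auto_derive; [exact H1|field; exact H1].
Qed.

(** For 1 / (1 - z) the Bloch seminorm is at most 4 because
    (1 - r^2)^alpha <= (1 - r^2)^2 <= 4 (1 - r)^2. *)
Lemma does_not_map_of_ge_2 (alpha : R) : 2 <= alpha -> hilbert_does_not_map alpha.
Proof.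
  intros Hal; exists (CPSeries (fun _ => 1)); split.
  - apply in_bloch_CPSeries with (M := 4); [intros; lra|apply ones_radius|].
    intros r Hr; rewrite PSeries_derive_ones by (rewrite Rabs_pos_eq; lra).
    assert (Hu : 0 < 1 - r ^ 2 <= 1) by (split; nra).
    assert (HW : bloch_weight alpha r <= (1 - r ^ 2) ^ 2).
    { unfold bloch_weight; rewrite <- (Rpower_pow 2 (1 - r ^ 2)) by lra.
      assert (Hln : ln (1 - r ^ 2) <= 0) by (rewrite <- ln_1; apply ln_le; lra).
      assert (Hm : alpha * ln (1 - r ^ 2) <= INR 2 * ln (1 - r ^ 2)) by (simpl INR; nra).
      unfold Rpower; destruct Hm as [Hm|Hm];
        [left; now apply exp_increasing|rewrite Hm; lra]. }
    assert (Hi : 0 < / (1 - r) ^ 2) by (apply Rinv_0_lt_compat, pow_lt; lra).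
    apply Rle_trans with ((1 - r ^ 2) ^ 2 * / (1 - r) ^ 2).
    { apply Rmult_le_compat_r; lra. }
    replace ((1 - r ^ 2) ^ 2 * / (1 - r) ^ 2) with ((1 + r) ^ 2) by (field; lra).
    nra.
  - left; intros (g & a & b & Ha & Hab & _).
    apply harmonic_diverges; exists (Re (b 0%nat)).
    generalize (is_Cseries_Re _ _ (Hab 0%nat)); apply is_series_ext; intros k.
    rewrite Nat.add_0_l, Nat.add_1_r.
    assert (Hk : INR (S k) <> 0) by (apply not_0_INR; discriminate).
    unfold Cdiv; rewrite <- RtoC_inv, re_scal_r by exact Hk.
    rewrite (power_series_coef_Re a (fun _ => 1) k ones_radius Ha); apply Rmult_1_l.
Qed.

Definition const_coef (n : nat) : R := match n with 0%nat => 1 | S _ => 0 end.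

Lemma const_coef_nonneg (n : nat) : 0 <= const_coef n.
Proof. destruct n; simpl; lra. Qed.

Lemma const_coef_radius : Rbar_le 1 (CV_radius const_coef).
Proof.
  apply (CV_radius_ge_1 _ 1); intros [|n]; simpl; rewrite ?Rabs_R0, ?Rabs_R1; lra.
Qed.

Lemma is_series_const_coef (n : nat) :
  is_series (fun k => const_coef k / INR (n + k + 1)) (/ INR (S n)).
Proof.
  apply (filterlim_ext (fun _ => / INR (S n))); [|apply filterlim_const].
  intros N; induction N as [|N IH].
  - rewrite sum_O, Nat.add_0_r, Nat.add_1_r; symmetry; apply Rmult_1_l.
  - rewrite sum_Sn, <- IH; symmetry.
    change (/ INR (S n) + 0 * / INR (n + S N + 1) = / INR (S n)).
    now rewrite Rmult_0_l, Rplus_0_r.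
Qed.

(** The derivative has coefficients (n + 1) / (n + 2) >= 1/2: compare with half
    the geometric series. *)
Lemma PSeries_derive_hilbert_const_ge (r : R) :
  0 <= r < 1 -> / (2 * (1 - r)) <= PSeries (PS_derive (fun n => / INR (S n))) r.
Proof.
  intros Hr; assert (Hra : Rabs r < 1) by (rewrite Rabs_pos_eq; lra).
  rewrite Rinv_mult, <- PSeries_ones, <- PSeries_scal by exact Hra.
  apply Series_le.
  - intros n; assert (Hp : 0 <= r ^ n) by (apply pow_le; lra).
    change (0 <= / 2 * 1 * r ^ n <= INR (S n) * / INR (S (S n)) * r ^ n).
    assert (Hn := pos_INR n); split; [lra|apply Rmult_le_compat_r; [exact Hp|]].
    rewrite !S_INR; apply Rmult_le_reg_r with (INR n + 1 + 1); [lra|].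
    rewrite (Rmult_assoc (INR n + 1)), Rinv_l by lra; lra.
  - apply (proj1 (ex_pseries_R _ _)), CV_radius_inside; rewrite CV_radius_derive.
    apply disk_lt_radius; [|exact Hra].
    apply (CV_radius_ge_1 _ 1); intros n; rewrite Rabs_pos_eq.
    + rewrite <- Rinv_1; apply Rinv_le_contravar; [lra|rewrite S_INR].
      assert (Hn := pos_INR n); lra.
    + apply Rlt_le, Rinv_0_lt_compat, lt_0_INR; lia.
Qed.

Lemma exp_ge_sqr (x : R) : 0 <= x -> x ^ 2 / 4 <= exp x.
Proof.
  intros Hx; replace (exp x) with (exp (x / 2) * exp (x / 2)).
  - assert (H := exp_ineq1_le (x / 2)); nra.
  - rewrite <- exp_plus; f_equal; field.
Qed.

(** With r = 1 - e^(-u) the logarithm is 1 + 2u <= 3u, and the power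
    e^((1 - alpha) u) is at least ((1 - alpha) u)^2 / 4; the constant 24 is
    2 * 3 * 4. *)
Lemma bloch_log_weight_blowup (alpha u : R) :
  0 < alpha < 1 -> 1 <= u ->
  (1 - alpha) ^ 2 * u / 24 <= bloch_log_weight alpha (1 - exp (- u)) * / (2 * exp (- u)).
Proof.
  intros Hal Hu; set (s := exp (- u)).
  assert (Hs : 0 < s < 1).
  { split; [apply exp_pos|rewrite <- exp_0; apply exp_increasing; lra]. }
  unfold bloch_log_weight.
  replace (1 - (1 - s)) with s by ring.
  assert (Hl : ln (exp 1 / s ^ 2) = 1 + 2 * u).
  { rewrite ln_div by (try apply exp_pos; apply pow_lt; lra).
    rewrite ln_exp, ln_pow by lra; unfold s; rewrite ln_exp; simpl; ring. }
  rewrite Hl.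
  assert (HP : exp (- (alpha * u)) <= Rpower (1 - (1 - s) ^ 2) alpha).
  { replace (- (alpha * u)) with (alpha * ln s) by (unfold s; rewrite ln_exp; ring).
    apply (Rle_Rpower_l s (1 - (1 - s) ^ 2) alpha); [lra|split; nra]. }
  assert (HE := exp_ge_sqr ((1 - alpha) * u) ltac:(nra)).
  assert (Hse : exp (- (alpha * u)) * / s = exp ((1 - alpha) * u)).
  { unfold s; rewrite <- exp_Ropp, <- exp_plus; f_equal; ring. }
  assert (Hi : 0 < / (1 + 2 * u)) by (apply Rinv_0_lt_compat; lra).
  assert (His : 0 < / s) by (apply Rinv_0_lt_compat; lra).
  rewrite Rinv_mult.
  apply Rle_trans with (/ (1 + 2 * u) * / 2 * (exp (- (alpha * u)) * / s)).
  - rewrite Hse.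
    apply Rle_trans with (/ (1 + 2 * u) * / 2 * (((1 - alpha) * u) ^ 2 / 4)).
    + apply Rmult_le_reg_l with (1 + 2 * u); [lra|].
      replace ((1 + 2 * u) * (/ (1 + 2 * u) * / 2 * (((1 - alpha) * u) ^ 2 / 4)))
        with ((1 - alpha) ^ 2 * u / 24 * (3 * u)) by (field; lra).
      rewrite (Rmult_comm (1 + 2 * u)); apply Rmult_le_compat_l; [|lra].
      assert (0 <= (1 - alpha) ^ 2) by apply pow2_ge_0; nra.
    + apply Rmult_le_compat_l; [nra|exact HE].
  - replace (/ (1 + 2 * u) * Rpower (1 - (1 - s) ^ 2) alpha * (/ 2 * / s)) with
      (/ (1 + 2 * u) * / 2 * (Rpower (1 - (1 - s) ^ 2) alpha * / s)) by ring.
    apply Rmult_le_compat_l; [nra|].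
    apply Rmult_le_compat_r; lra.
Qed.

Lemma does_not_map_of_lt_1 (alpha : R) : 0 < alpha < 1 -> hilbert_does_not_map alpha.
Proof.
  intros Hal; set (b := fun n => / INR (S n)).
  assert (Hb : forall n, 0 <= b n <= 1).
  { intros n; assert (Hn := pos_INR n); unfold b; split.
    - apply Rlt_le, Rinv_0_lt_compat, lt_0_INR; lia.
    - rewrite <- Rinv_1; apply Rinv_le_contravar; [lra|rewrite S_INR; lra]. }
  assert (Hbr : Rbar_le 1 (CV_radius b)).
  { apply (CV_radius_ge_1 _ 1); intros n; specialize (Hb n); rewrite Rabs_pos_eq; lra. }
  exists (CPSeries const_coef); split.
  - apply in_bloch_CPSeries with (M := 0);
      [apply const_coef_nonneg|apply const_coef_radius|].
    intros r Hr; rewrite (PSeries_ext _ (fun _ => 0)).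
    + rewrite PSeries_const_0; lra.
    + intros n; unfold PS_derive; simpl const_coef; ring.
  - right; exists (CPSeries b); split.
    + apply is_hilbert_CPSeries; [apply const_coef_radius|exact Hbr|].
      intros n; apply is_series_const_coef.
    + intros [_ Hfin].
      assert (Hge : forall u, 1 <= u ->
        Rbar_le ((1 - alpha) ^ 2 * u / 24) (bloch_log_norm alpha (CPSeries b))).
      { intros u Hu.
        assert (Hs : 0 < exp (- u) < 1).
        { split; [apply exp_pos|rewrite <- exp_0; apply exp_increasing; lra]. }
        assert (Hr : Rabs (1 - exp (- u)) = 1 - exp (- u)) by (apply Rabs_pos_eq; lra).
        eapply Rbar_le_trans;
          [|apply (weighted_norm_ge _ _ (RtoC (1 - exp (- u))))].
        2:{ unfold in_disk; rewrite Cmod_R; lra. }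
        assert (Hrad : Rbar_lt (Rabs (1 - exp (- u))) (CV_radius b)).
        { apply disk_lt_radius; [exact Hbr|lra]. }
        rewrite C_derive_CPSeries, (CPSeries_RtoC (PS_derive b))
          by (rewrite ?Cmod_R, ?CV_radius_derive; exact Hrad).
        rewrite !(Cmod_R (1 - _)), Hr, (Cmod_R (PSeries _ _)); simpl Rbar_le.
        assert (Hd := PSeries_derive_hilbert_const_ge (1 - exp (- u)) ltac:(lra)).
        replace (1 - (1 - exp (- u))) with (exp (- u)) in Hd by ring.
        assert (Hw := bloch_log_weight_blowup alpha u Hal Hu).
        assert (Hd2 := Rle_trans _ _ _ Hd (Rle_abs _)).
        assert (Hi : 0 < / (2 * exp (- u))) by (apply Rinv_0_lt_compat; lra).
        assert (Hc := pow2_ge_0 (1 - alpha)).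
        assert (Hwpos : 0 <= bloch_log_weight alpha (1 - exp (- u))).
        { apply Rmult_le_reg_r with (1 := Hi); rewrite Rmult_0_l; nra. }
        assert (H0 := Cmod_ge_0 (CPSeries b (RtoC 0))).
        assert (Hm := Rmult_le_compat_l _ _ _ Hwpos Hd2); fold b in Hm; lra. }
      destruct (bloch_log_norm alpha (CPSeries b)) as [K| |]; [|easy|exact (Hge 1 (Rle_refl 1))].
      assert (Hc : 0 < (1 - alpha) ^ 2) by (apply pow_lt; lra).
      assert (HK : 0 <= 24 * (Rabs K + 1) / (1 - alpha) ^ 2).
      { apply Rlt_le, Rdiv_lt_0_compat; [assert (H := Rabs_pos K); lra|exact Hc]. }
      (* This u makes the lower bound exceed |K| + 1. *)
      specialize (Hge (1 + 24 * (Rabs K + 1) / (1 - alpha) ^ 2) ltac:(lra)).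
      cbn [Rbar_le] in Hge.
      replace ((1 - alpha) ^ 2 * (1 + 24 * (Rabs K + 1) / (1 - alpha) ^ 2) / 24)
        with ((1 - alpha) ^ 2 / 24 + Rabs K + 1) in Hge by (field; lra).
      assert (H := Rle_abs K). lra.
Qed.

Theorem theorem6p1 :
  (forall alpha : R, 1 < alpha < 2 ->
     Rbar_le
       (Finite
          (1 / (2 * (alpha - 1)) *
             RInt_gen (fun t : R => Rpower (1 - t ^ 2) (1 - alpha))
               (at_point 0) (at_left 1)
           + (3 * alpha - 5) / (4 * (alpha - 1) * (2 - alpha))))
       (hilbert_norm alpha)) /\
  (forall alpha : R, (0 < alpha < 1 \/ 2 <= alpha) ->
     hilbert_does_not_map alpha).
Proof.
  split; [exact hilbert_norm_lower_bound|].
  intros alpha [H|H]; [now apply does_not_map_of_lt_1|now apply does_not_map_of_ge_2].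
Qed.
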